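(* The inequality $2r(A)\ge|A|$ does not hold in general for formally self-dual codes: there exist a formally self-dual linear code $C\subseteq\mathbb{F}_q^n$ and a set $A\subseteq\{1,\ldots,n\}$ of columns of a generator matrix of $C$ such that $2r(A)<|A|$.
   Context: $\mathbb{F}_q$ is the finite field with $q$ elements. A linear code of length $n$ is a linear subspace $C\subseteq\mathbb{F}_q^n$; its dual $C^\perp$ is the orthogonal complement for the standard inner product. The code $C$ is formally self-dual if $C$ and $C^\perp$ have the same weight enumerator, i.e. for every $i$ they contain the same number of words with exactly $i$ nonzero coordinates. A generator matrix of $C$ is a matrix whose rows form a basis of $C$; for $A\subseteq\{1,\ldots,n\}$, $r(A)$ is the rank of the submatrix of a generator matrix formed by the columns indexed by $A$. *)

(* Defs.v *)
From mathcomp Require Import all_boot all_order all_algebra.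

Set Implicit Arguments.
Unset Strict Implicit.
Unset Printing Implicit Defensive.

Import GRing.Theory.
Local Open Scope ring_scope.

(* A linear code of length n over F is a subspace C : {vspace 'rV[F]_n}. *)

Definition dotv (F : finFieldType) (n : nat) (x y : 'rV[F]_n) : F :=
  \sum_(i < n) x 0 i * y 0 i.

Definition dual_code (F : finFieldType) (n : nat) (C : {vspace 'rV[F]_n}) :
    {set 'rV[F]_n} :=
  [set x | [forall y in C, dotv x y == 0]].

Definition weight (F : finFieldType) (n : nat) (x : 'rV[F]_n) : nat :=
  #|[set i : 'I_n | x 0 i != 0]|.

(* The i-th coefficient of the weight enumerator of S. *)
Definition weight_count (F : finFieldType) (n : nat) (S : {pred 'rV[F]_n})
    (i : nat) : nat :=
  #|[set x : 'rV[F]_n | (x \in S) && (weight x == i)]|.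

Definition formally_self_dual (F : finFieldType) (n : nat)
    (C : {vspace 'rV[F]_n}) : Prop :=
  forall i : nat,
    weight_count (mem C) i = weight_count (mem (dual_code C)) i.

(* This forces k = \dim C. *)
Definition generator_matrix (F : finFieldType) (k n : nat)
    (G : 'M[F]_(k, n)) (C : {vspace 'rV[F]_n}) : Prop :=
  basis_of C [seq row i G | i <- enum 'I_k].

(* enum_val lists the elements of A, so colsub keeps the columns in A. *)
Definition column_rank (F : finFieldType) (k n : nat) (G : 'M[F]_(k, n))
    (A : {set 'I_n}) : nat :=
  \rank (colsub (fun j : 'I_#|A| => enum_val j) G).

(* Main.v *)
Require Import Defs.
From mathcomp Require Import all_boot all_order all_algebra.
From mathcomp Require Import fingroup perm.

(** If [D] is any code, [D (+) D^_|_] has dual [D^_|_ (+) D], which is the same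
    code up to a permutation of the coordinates, so it is formally self-dual.
    For [D = 0] of length 1 this is the code spanned by (0, 1), whose first
    column has rank 0. *)

Import GRing.Theory.
Local Open Scope ring_scope.

(** Entry [i] of [col_perm s x] is entry [s i] of [x], so [s] maps the support of the former onto
    that of the latter. *)
Lemma weight_col_perm (F : finFieldType) (n : nat) (s : 'S_n) (x : 'rV[F]_n) :
  weight (col_perm s x) = weight x.
Proof.
rewrite /weight -(card_imset _ (@perm_inj _ s)); apply: eq_card => i.
rewrite inE; apply/imsetP/idP => [[j] | xi].
  by rewrite inE mxE => xj ->.
by exists (s^-1%g i); rewrite ?inE ?mxE permKV.
Qed.

(** The hypothesis makes [col_perm s] a weight-preserving bijection from [S] onto [T]; it is meant
    for a code and its dual. *)
Lemma weight_count_col_perm (F : finFieldType) (n : nat) (s : 'S_n)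
    (S T : {pred 'rV[F]_n}) (i : nat) :
  (forall x, (col_perm s x \in T) = (x \in S)) ->
  weight_count S i = weight_count T i.
Proof.
move=> ST; rewrite /weight_count.
have K : cancel (@col_perm F 1 n s) (col_perm s^-1%g).
  by move=> x; rewrite -col_permM mulVg col_perm1.
have K' : cancel (@col_perm F 1 n s^-1%g) (col_perm s).
  by move=> x; rewrite -col_permM mulgV col_perm1.
rewrite -(card_imset _ (can_inj K)); apply: eq_card => y.
rewrite -(K' y) mem_imset; last exact: can_inj K.
by rewrite !inE ST !weight_col_perm.
Qed.

Lemma mem_line_delta1 (F : finFieldType) (x : 'rV[F]_2) :
  (x \in vline (delta_mx 0 1 : 'rV[F]_2)) = (x 0 0 == 0).
Proof.
apply/vlineP/eqP => [[a ->] | x0]; first by rewrite !mxE mulr0.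
exists (x 0 1); apply/rowP => j; rewrite !mxE /=.
by case: (altP (j =P 1)) => [-> | j1]; rewrite ?mulr1 ?mulr0 // -x0;
  congr (x 0 _); apply/val_inj; case: j j1 => [[|[|]]].
Qed.

Lemma mem_dual_line_delta1 (F : finFieldType) (x : 'rV[F]_2) :
  (x \in dual_code (vline (delta_mx 0 1 : 'rV[F]_2))) = (x 0 1 == 0).
Proof.
(* Pairing with the generator alone isolates coordinate 1. Conversely, a word [y] of the line has
   first entry 0, so only the product at coordinate 1 survives. *)
rewrite inE; apply/forall_inP/eqP => [/(_ _ (memv_line _))/eqP | x1 y].
  by rewrite /dotv big_ord_recl big_ord1 !mxE /= mulr0 mulr1 add0r => <-;
    congr (x 0 _); apply/val_inj.
rewrite mem_line_delta1 /dotv big_ord_recl big_ord1 => /eqP y0.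
rewrite y0 mulr0 add0r (_ : lift _ _ = 1) ?x1 ?mul0r //.
exact/val_inj.
Qed.

Lemma formally_self_dual_line_delta1 (F : finFieldType) :
  formally_self_dual (vline (delta_mx 0 1 : 'rV[F]_2)).
Proof.
(* Swapping the two coordinates exchanges the equations defining the line and its dual. *)
move=> i; apply: (@weight_count_col_perm _ _ (tperm 0 1)) => x.
by rewrite mem_dual_line_delta1 mem_line_delta1 mxE tpermR.
Qed.

Theorem mainTheorem6 (F : finFieldType) :
  exists (n : nat) (C : {vspace 'rV[F]_n}) (k : nat) (G : 'M[F]_(k, n))
         (A : {set 'I_n}),
    formally_self_dual C /\
    generator_matrix G C /\
    (2 * column_rank G A < #|A|)%N.
Proof.
pose v : 'rV[F]_2 := delta_mx 0 1.
(* The spanning row [v] is its own generator matrix, and [A] is the coordinate where every codeword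
   vanishes. *)
exists 2, <[v]>%VS, 1, v, [set 0].
split; [exact: formally_self_dual_line_delta1 | split].
- rewrite /generator_matrix enum_ordSl (size0nil (size_enum_ord 0)) /= row_id.
  apply: seq1_basis; apply/eqP => /rowP/(_ 1).
  by rewrite !mxE eqxx => /eqP; rewrite oner_eq0.
- rewrite /column_rank (_ : colsub _ _ = 0) ?mxrank0 ?cards1 //.
  apply/matrixP => i j; rewrite !mxE.
  by have := enum_valP j; rewrite inE => /eqP ->; rewrite andbF.
Qed.
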